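(* If an algorithm $G$ non-uniformly generates for a collection $\mathcal C$, then $G$ also non-uniformly generates for $\mathcal C$ with infinite omissions.
   Context: A language is an infinite subset of a countably infinite universe $U$; a collection is a set of languages. A generator algorithm is an arbitrary function $G$ from finite sequences of elements of $U$ to $U$, with output $z_t=G(x_0,\dots,x_t)$, and $S_t=\{x_0,\dots,x_t\}$. An enumeration of $K$ is an infinite sequence of pairwise distinct elements of $K$ containing every element of $K$. An enumeration of $K$ with infinite omissions is any infinite sequence of pairwise distinct elements of $K$. $G$ non-uniformly generates for $\mathcal C$ if for every $K\in\mathcal C$ there is $t^\star$ such that for every enumeration $x$ of $K$ and every $t\ge t^\star$, $z_t\in K\setminus S_t$. $G$ non-uniformly generates with infinite omissions for $\mathcal C$ if the same holds with ''enumeration'' replaced by ''enumeration with infinite omissions''. *)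

(* Defs.v *)
From mathcomp Require Import all_boot.
From mathcomp Require Import boolp classical_sets functions cardinality.

Set Implicit Arguments.
Unset Strict Implicit.
Unset Printing Implicit Defensive.

Local Open Scope classical_set_scope.

Definition language (U : Type) (K : set U) : Prop := infinite_set K.

Definition collection (U : Type) (C : set (set U)) : Prop :=
  forall K : set U, C K -> language K.

Definition generator (U : Type) : Type := seq U -> U.

Definition output (U : Type) (G : generator U) (x : nat -> U) (t : nat) : U :=
  G (mkseq x t.+1).

(* `I_t.+1 is {0, ..., t}, so this is {x_0, ..., x_t} *)
Definition seen (U : Type) (x : nat -> U) (t : nat) : set U := x @` `I_t.+1.

Definition enumeration (U : Type) (K : set U) (x : nat -> U) : Prop :=
  [/\ injective x, forall n, K (x n) & forall u, K u -> exists n, x n = u].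

Definition enumeration_with_infinite_omissions
    (U : Type) (K : set U) (x : nat -> U) : Prop :=
  injective x /\ forall n, K (x n).

(* t0 is chosen before x: it may depend on K but not on the enumeration *)
Definition nonuniformly_generates
    (U : Type) (G : generator U) (C : set (set U)) : Prop :=
  forall K : set U, C K ->
    exists t0 : nat, forall x : nat -> U, enumeration K x ->
      forall t : nat, t0 <= t -> (K `\` seen x t) (output G x t).

Definition nonuniformly_generates_with_infinite_omissions
    (U : Type) (G : generator U) (C : set (set U)) : Prop :=
  forall K : set U, C K ->
    exists t0 : nat, forall x : nat -> U,
      enumeration_with_infinite_omissions K x ->
      forall t : nat, t0 <= t -> (K `\` seen x t) (output G x t).

(* Main.v *)
Require Import Defs.
From mathcomp Require Import all_boot.
From mathcomp Require Import boolp classical_sets functions cardinality.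

Local Open Scope classical_set_scope.
Local Open Scope card_scope.

(** The output at time [t] depends only on [x_0, ..., x_t], and every finite
    injective prefix in [K] extends to an enumeration of [K]: list the countably
    infinite set [K \ {x_0, ..., x_t}] after the prefix. Since [t0] does not
    depend on the enumeration, the guarantee for that extension at time [t] is
    the one needed for [x]. *)

Lemma countable_infinite_enumeration (U : Type) (K : set U) :
  countable K -> infinite_set K -> exists x : nat -> U, enumeration K x.
Proof.
move=> cK iK; have /card_set_bijP[g [gfun ginj gsurj]] := eq_card_nat cK iK.
(* The enumeration is a right inverse of the bijection [g] from [K] to the naturals; injectivity of
   [g] on [K] makes it exhaust [K]. *)
have /choice[x xP] : forall n, exists u, K u /\ g u = n.
  by move=> n; have [//|u Ku gu] := gsurj n; exists u.
exists x; split=> [m n xmn|n|u Ku]; first 1 last.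
- by have [] := xP n.
- exists (g u); have [Kx gx] := xP (g u).
  by apply: ginj gx; apply/mem_set.
- by rewrite -(xP m).2 -(xP n).2 xmn.
Qed.

Lemma enumeration_extending_prefix (U : Type) (K : set U) (x : nat -> U)
    (t : nat) :
  countable K -> infinite_set K -> injective x -> (forall n, K (x n)) ->
  exists2 y : nat -> U, enumeration K y & forall i, i <= t -> y i = x i.
Proof.
move=> cK iK xinj xK; pose A := seen x t.
have finA : finite_set A by exact/finite_image/finite_II.
have cKA : countable (K `\` A).
  exact: sub_countable (subset_card_le (@subDsetl _ K A)) cK.
have [z [zinj zK zsurj]] :=
  countable_infinite_enumeration _ _ cKA (infinite_setD iK finA).
have xA i : i <= t -> A (x i) by move=> it; exists i.
(* The prefix fills the indices up to [t], so [z] starts at index [t.+1]. *)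
exists (fun i => if i <= t then x i else z (i - t.+1)); last by move=> i ->.
split=> [i j|n|u Ku].
- case: (leqP i t) (leqP j t) => [it|ti] [jt|tj] => [/xinj//|xz|zx|/zinj eqij].
  (* A prefix term lies in [A], which [z] avoids, so the two pieces never collide. *)
  + by have [_ []] := zK (j - t.+1); rewrite -xz; exact: xA.
  + by have [_ []] := zK (i - t.+1); rewrite zx; exact: xA.
  + by rewrite -(subnK ti) eqij subnK.
- by case: ifP => // _; have [] := zK (n - t.+1).
- have [[i it <-]|nAu] := pselect (A u); first by exists i; rewrite -ltnS it.
  have [n <-] := zsurj u (conj Ku nAu).
  by exists (n + t.+1); rewrite addnK leqNgt leq_addl.
Qed.

Theorem theorem4p6 (U : Type) (hU : [set: U] #= [set: nat])
    (C : set (set U)) (hC : collection C) (G : generator U) :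
  nonuniformly_generates G C ->
  nonuniformly_generates_with_infinite_omissions G C.
Proof.
move=> genG K CK; have [t0 t0P] := genG K CK.
exists t0 => x [xinj xK] t le_t0t.
have cK : countable K.
  apply: sub_countable (subset_card_le (@subsetT _ K)) _.
  by move: hU; rewrite card_eq_le => /andP[].
have [y enumy yx] := enumeration_extending_prefix _ _ _ t cK (hC K CK) xinj xK.
have -> : output G x t = output G y t.
  (* [mkseq] maps over [iota 0 t.+1], so only indices up to [t] are compared. *)
  congr G; apply/eq_in_map => i; rewrite mem_iota => /andP[_ it].
  by rewrite yx.
have -> : seen x t = seen y t by apply: eq_imagel => i it; rewrite yx.
exact: t0P.
Qed.
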